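(* For every non-trivial barrier $\mathcal{B}$ on $\omega$ we have $\mathfrak{par}_{\mathcal{B}}=\mathfrak{par}_2$, and $\mathfrak{par}_{[\omega]^1}=\mathfrak{s}$.
   Context: For sets of naturals, $s\sqsubseteq t$ means $s$ is an initial segment of $t$. For $\mathcal{F}\subseteq[\omega]^{<\omega}$ and $M\subseteq\omega$ let $\mathcal{F}|M=\{s\in\mathcal{F}:s\subseteq M\}$. A barrier on $\omega$ is a family $\mathcal{B}$ of nonempty finite subsets of $\omega$ such that (a) $s\subseteq t$ implies $s=t$ for $s,t\in\mathcal{B}$, and (b) every infinite $N\subseteq\omega$ has an initial segment $s\sqsubseteq N$ with $s\in\mathcal{B}$. A barrier is non-trivial if $\mathcal{B}\neq[\omega]^1$. For a coloring $\pi:\mathcal{B}\to2$, an infinite $H\subseteq\omega$ is monochromatic for $\pi$ if $\pi$ is constant on $\mathcal{B}|H$, and almost monochromatic for $\pi$ if $H\setminus F$ is monochromatic for $\pi$ for some finite $F\subseteq H$. $H$ is almost monochromatic for a family $\Pi$ of colorings if it is so for every $\pi\in\Pi$. $\mathfrak{par}_{\mathcal{B}}$ is the minimum size of a collection of colorings $\mathcal{B}\to2$ without an infinite almost monochromatic set, and $\mathfrak{par}_2=\mathfrak{par}_{[\omega]^2}$. $\mathfrak{s}$ is the splitting number: the least size of a family $\mathcal{S}\subseteq[\omega]^\omega$ such that for every infinite $A\subseteq\omega$ there is $S\in\mathcal{S}$ with $A\cap S$ and $A\setminus S$ both infinite. *)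

(* Defs.v *)
From mathcomp Require Import all_boot all_order.
From mathcomp Require Import mathcomp_extra boolp classical_sets functions cardinality.

Set Implicit Arguments.
Unset Strict Implicit.
Unset Printing Implicit Defensive.

Local Open Scope classical_set_scope.
Local Open Scope card_scope.

(* Subsets of omega, finite or infinite, are all of type [set nat]. *)

Definition initial_segment (s t : set nat) : Prop :=
  s `<=` t /\ forall x y : nat, s x -> t y -> (y < x)%N -> s y.

Definition subsets_of_size (n : nat) : set (set nat) := [set s | s #= `I_n].

Definition restrict_family (F : set (set nat)) (M : set nat) : set (set nat) :=
  [set s | F s /\ s `<=` M].

Record barrier (B : set (set nat)) : Prop := Barrier {
  barrier_finite : forall s, B s -> finite_set s;
  barrier_nonempty : forall s, B s -> s !=set0;
  barrier_antichain : forall s t, B s -> B t -> s `<=` t -> s = t;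
  barrier_segment : forall N : set nat, infinite_set N ->
    exists2 s, B s & initial_segment s N }.

Definition nontrivial_barrier (B : set (set nat)) : Prop :=
  barrier B /\ B <> subsets_of_size 1.

(* A coloring is defined on the elements of B only: [B -> bool] is
   [set_type B -> bool]. *)
Definition monochromatic (B : set (set nat)) (pi : B -> bool) (H : set nat) :
    Prop :=
  infinite_set H /\
  exists c : bool, forall s : B, restrict_family B H (set_val s) -> pi s = c.

Definition almost_monochromatic (B : set (set nat)) (pi : B -> bool)
    (H : set nat) : Prop :=
  infinite_set H /\
  exists F : set nat, [/\ finite_set F, F `<=` H & monochromatic pi (H `\` F)].

Definition no_almost_monochromatic (B : set (set nat)) : set (set (B -> bool)) :=
  [set Pi | ~ exists H : set nat, infinite_set H /\
              forall pi, Pi pi -> almost_monochromatic pi H].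

Definition splitting_family : set (set (set nat)) :=
  [set S | (forall X, S X -> infinite_set X) /\
           forall A : set nat, infinite_set A ->
             exists X, [/\ S X, infinite_set (A `&` X) & infinite_set (A `\` X)]].

(* Cardinal numbers are represented by sets up to equipotence: [is_min_size P K]
   says that the minimum of the cardinalities of the members of P is attained
   and equals the cardinality of K. *)
Definition is_min_size (T U : Type) (P : set (set T)) (K : set U) : Prop :=
  (exists2 X, P X & X #= K) /\ forall X, P X -> K #<= X.

(* All three numbers below are at most the continuum, so subsets of the power
   set of omega suffice to represent them. *)
Definition is_par (B : set (set nat)) (K : set (set nat)) : Prop :=
  is_min_size (@no_almost_monochromatic B) K.

Definition is_par2 (K : set (set nat)) : Prop := is_par (subsets_of_size 2) K.

Definition is_splitting_number (K : set (set nat)) : Prop :=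
  is_min_size splitting_family K.

(* Main.v *)
Require Import Defs.
From mathcomp Require Import all_boot all_order.
From mathcomp Require Import mathcomp_extra boolp classical_sets functions cardinality.
From mathcomp Require Import zify.

(* To compare two of the cardinals, one works with families of colorings indexed
   by a fixed type I and shows that if every such family on one barrier has a
   common almost homogeneous set, then so does every such family on the other.
   From B to pairs, a pair coloring is read off the first two elements of the
   members of B.  From pairs to B, one goes by induction on the well-founded tree
   of initial segments of members of B: a node s has all its extensions s + {k}
   solved by sets H_k; along a pseudo-intersection of the H_k each coloring of
   index i gets, for each k, a limit color c_i(k) valid beyond a threshold f_i(k).
   The pair colorings {k < x} |-> c_i(k) and {k < x} |-> [f_i(k) <= x] then yield
   a set that solves s. *)

Set Implicit Arguments.
Unset Strict Implicit.
Unset Printing Implicit Defensive.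

Local Open Scope classical_set_scope.
Local Open Scope card_scope.

(** * Infinite sets of naturals and increasing sequences *)

Lemma finite_set_natP (A : set nat) :
  finite_set A <-> exists n, forall x, A x -> (x < n)%N.
Proof.
split=> [|[n An]]; last by apply: sub_finite_set (finite_II n) => x /An.
move=> /finite_seqP[X ->]; exists (\max_(x <- X) x).+1 => x /= xX.
by rewrite ltnS (@leq_bigmax_seq _ X xpredT id x).
Qed.

Lemma infinite_set_natP (A : set nat) :
  infinite_set A <-> forall n, exists2 m, A m & (n <= m)%N.
Proof.
split=> [Ainf n|Aunb /finite_set_natP[n An]].
  apply: contrapT => noA; apply: Ainf; apply/finite_set_natP.
  exists n => x Ax; rewrite ltnNge; apply/negP => nx.
  by apply: noA; exists x.
have [m Am nm] := Aunb n.
by have := An _ Am; rewrite ltnNge nm.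
Qed.

(** For constant [A] this gives an increasing sequence inside one infinite set; for decreasing [A]
    the range of [e] is a pseudo-intersection. *)
Lemma infinite_diagonal (A : nat -> set nat) :
  (forall j, infinite_set (A j)) ->
  exists2 e : nat -> nat, {homo e : i j / (i < j)%N} & forall j, A j (e j).
Proof.
move=> Ainf.
have /choice[f fP] : forall jn : nat * nat,
    exists m, A jn.1 m /\ (jn.2 <= m)%N.
  move=> [j n]; have /infinite_set_natP/(_ n)[m Am nm] := Ainf j.
  by exists m.
pose fix e j := if j is j'.+1 then f (j, (e j').+1) else f (0, 0).
exists e => [|[|j]]; last 2 first.
- by have [] := fP (0, 0).
- by have [] := fP (j.+1, (e j).+1).
apply: homo_ltn => [? ? ?|j]; first exact: ltn_trans.
by have [] := fP (j.+1, (e j).+1).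
Qed.

Lemma homo_ltn_ge_id (e : nat -> nat) :
  {homo e : i j / (i < j)%N} -> forall j, (j <= e j)%N.
Proof.
by move=> eS; elim=> // j IH; apply: leq_ltn_trans IH _; exact: eS.
Qed.

Lemma homo_ltn_mono (e : nat -> nat) :
  {homo e : i j / (i < j)%N} -> {mono e : i j / (i < j)%N}.
Proof.
move=> eS i j; case: (ltngtP i j) => [/eS//|/eS/ltnW|->]; last by rewrite ltnn.
by rewrite leqNgt => /negbTE.
Qed.

Lemma infinite_image_homo (e : nat -> nat) (A : set nat) :
  {homo e : i j / (i < j)%N} -> infinite_set A -> infinite_set (e @` A).
Proof.
move=> eS /infinite_set_natP Ainf; apply/infinite_set_natP => n.
have [m Am nm] := Ainf n; exists (e m); first by exists m.
exact: leq_trans nm (homo_ltn_ge_id eS m).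
Qed.

Lemma nonempty_nat_min (A : set nat) :
  A !=set0 -> exists2 k, A k & forall x, A x -> (k <= x)%N.
Proof.
move=> [a Aa]; have exA : exists n, n \in A by exists a; rewrite inE.
case: (ex_minnP exA) => k; rewrite inE => Ak kmin; exists k => // x Ax.
by apply: kmin; rewrite inE.
Qed.

(** * One- and two-element sets *)

Lemma subsets_of_size1P (s : set nat) :
  subsets_of_size 1 s <-> exists n, s = [set n].
Proof.
split=> [/eq_cardSP[x sx]|[n ->]]; last exact: card_set1.
rewrite II0 card_eq0 => /eqP s0; exists x.
by apply/seteqP; split=> [y sy|_ -> //]; apply: contrapT => yx;
   have : (s `\ x) y by []; rewrite s0.
Qed.

Lemma subsets_of_size2P (s : set nat) :
  subsets_of_size 2 s <-> exists a b, (a < b)%N /\ s = [set a; b].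
Proof.
split=> [/eq_cardSP[x sx]|[a [b [ab ->]]]]; last first.
  apply/eq_cardSP; exists a; first by left.
  suff -> : [set a; b] `\ a = [set b] by exact: card_set1.
  apply/seteqP; split=> [y [[->|->//] /(_ erefl)]//|_ ->]; split; first by right.
  by move=> /= ba; rewrite ba ltnn in ab.
move=> /subsets_of_size1P[y sxy].
have [sy yx] : (s `\ x) y by rewrite sxy.
have sE : s = [set x; y].
  apply/seteqP; split=> [z sz|z [->|->]//].
  by have [->|/eqP zx] := eqVneq z x; [left|right; rewrite -sxy].
case: (ltngtP x y) => [xy|xy|xy]; last by case: yx.
  by exists x, y.
by exists y, x; rewrite setUC.
Qed.

Lemma set2_ltn_inj (a b a' b' : nat) :
  (a < b)%N -> (a' < b')%N -> [set a; b] = [set a'; b'] -> a = a' /\ b = b'.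
Proof.
move=> ab ab' E.
have /= Ha : [set a'; b'] a by rewrite -E; left.
have /= Hb : [set a'; b'] b by rewrite -E; right.
have /= Ha' : [set a; b] a' by rewrite E; left.
have /= Hb' : [set a; b] b' by rewrite E; right.
by case: Ha; case: Hb; case: Ha'; case: Hb'; lia.
Qed.

(** * Almost homogeneous sets and transfer between families of colorings *)

(** Total functions on [set nat] avoid the subtype of [B], and a threshold replaces the deleted
    finite set. *)
Definition eventually_constant (B : set (set nat)) (p : set nat -> bool)
    (H : set nat) : Prop :=
  exists (n : nat) (c : bool), forall s, B s -> s `<=` H ->
    (forall x, s x -> (n <= x)%N) -> p s = c.

(** Expresses that the size of [I] is below the par number of [B], without naming a cardinal. *)
Definition homogenizable (B : set (set nat)) (I : Type) : Prop :=
  forall p : I -> set nat -> bool, exists2 H, infinite_set H &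
    forall i, eventually_constant B (p i) H.

Lemma almost_monochromaticP (B : set (set nat)) (pi : B -> bool)
    (p : set nat -> bool) (H : set nat) :
  (forall s : B, pi s = p (set_val s)) -> infinite_set H ->
  almost_monochromatic pi H <-> eventually_constant B p H.
Proof.
move=> pip Hinf; split.
  move=> [_ [F [/finite_set_natP[n Fn] FH [_ [c cP]]]]].
  exists n, c => s Bs sH sn.
  have := pip (SigSub (mem_set Bs)); rewrite /= => <-; apply: cP; split=> // x sx.
  by split; [exact: sH|move=> /Fn; rewrite ltnNge sn].
move=> [n [c cP]]; split=> //; exists (H `&` `I_n); split=> //.
- exact: finite_setIr.
- split; last first.
    exists c => s [Bs sH]; rewrite pip; apply: cP => // [x /sH[]//|x /sH[Hx]].
    by rewrite leqNgt => nHx; apply/negP => xn; apply: nHx.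
  apply/infinite_set_natP => m; move/infinite_set_natP: Hinf.
  move=> /(_ (m + n)%N)[k Hk mk]; exists k; last by lia.
  by split=> // -[_ /=]; lia.
Qed.

(** The family [X] serves as its own index type: the failure for [B] at [X] gives one for [C] at
    [X], and the colorings witnessing it, being indexed by [X], are no more numerous. *)
Lemma no_almost_monochromatic_transfer (B C : set (set nat))
    (X : set (set_type B -> bool)) :
  (forall I, homogenizable C I -> homogenizable B I) ->
  no_almost_monochromatic X ->
  exists2 Y : set (set_type C -> bool), no_almost_monochromatic Y & Y #<= X.
Proof.
move=> CB nX.
have : ~ homogenizable C X.
  move=> /CB hB; apply: nX.
  (* The value [false] outside [B] is arbitrary. *)
  pose p (i : X) (s : set nat) :=
    if pselect (B s) is left Bs then set_val i (SigSub (mem_set Bs)) else false.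
  have [H Hinf Hp] := hB p; exists H; split=> // pi Xpi.
  apply/(almost_monochromaticP (p := p (SigSub (mem_set Xpi)))) => // s.
  rewrite /p; case: pselect => [Bs|nBs].
    by congr pi; apply: val_inj.
  by exfalso; apply: nBs; exact: set_valP.
move=> /existsNP[p np].
pose q (i : X) (s : C) := p i (set_val s).
exists (range q); last first.
  by apply: card_le_trans (card_image_le _ _) _; rewrite (card_le_eql (card_setT X)).
move=> [H [Hinf Hq]]; apply: np; exists H => // i.
by apply/(almost_monochromaticP (pi := q i)) => //; apply: Hq; exists i.
Qed.

(** * Minimal cardinalities *)

Lemma is_min_size_transfer (T U V : Type) (P : set (set T)) (Q : set (set U))
    (K : set V) :
  (forall X, P X -> exists2 Y, Q Y & Y #<= X) ->
  (forall Y, Q Y -> exists2 X, P X & X #<= Y) ->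
  is_min_size P K -> is_min_size Q K.
Proof.
move=> PQ QP [[X PX XK] Kmin].
have Kle Y : Q Y -> K #<= Y.
  by move=> /QP[Z /Kmin KZ ZY]; exact: card_le_trans KZ ZY.
split=> //; have [Y QY YX] := PQ _ PX; exists Y => //.
by rewrite card_eq_le Kle// andbT -(card_le_eqr XK).
Qed.

(* Zorn gives a maximal set D of choice functions on P that pairwise differ at
   every member of P; by maximality the values of D exhaust some member X of P,
   so X is no larger than D, and evaluation embeds D into every member of P. *)
Lemma exists_min_card (T : Type) (P : set (set T)) :
  P !=set0 -> exists2 X, P X & forall Y, P Y -> X #<= Y.
Proof.
move=> [X0 PX0].
pose Q (D : set (set T -> T)) :=
  (forall f X, D f -> P X -> X (f X)) /\
  (forall f g X, D f -> D g -> P X -> f X = g X -> f = g).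
have [F FQ Ftot|D [[DX Dinj] Dmax]] := @Zorn_bigcup _ Q.
  split=> [f X [D FD Df]|f g X [D FD Df] [E FE Eg]]; first exact: (FQ _ FD).1.
  have [DE|ED] := Ftot _ _ FD FE.
    by apply: (FQ _ FE).2 => //; exact: DE.
  by apply: (FQ _ FD).2 => //; exact: ED.
have [X PX XD] : exists2 X, P X & forall x, X x -> exists2 f, D f & f X = x.
  apply: contrapT => noX.
  have new X : P X -> exists x, X x /\ forall f, D f -> f X <> x.
    move=> PX; apply: contrapT => nx; apply: noX; exists X => // x Xx.
    apply: contrapT => nf; apply: nx; exists x; split=> // f Df fx.
    by apply: nf; exists f.
  have [x0 _] := new _ PX0.
  have /choice[g gP] : forall X, exists x,
      P X -> X x /\ forall f, D f -> f X <> x.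
    move=> X; have [/new[x xP]|nPX] := EM (P X); first by exists x.
    by exists x0.
  apply: (Dmax (g |` D)).
    split=> [f Df|/(_ g (or_introl erefl)) Dg]; first by right.
    by have [_ /(_ _ Dg)] := gP _ PX0.
  split=> [f X [->|Df] PX|f f' X [->|Df] [->|Df'] PX //].
  - by have [] := gP _ PX.
  - exact: (DX f).
  - by move=> gf'; have [_ /(_ _ Df')] := gP _ PX; rewrite gf'.
  - by move=> fg; have [_ /(_ _ Df)] := gP _ PX; rewrite fg.
  - exact: Dinj.
exists X => // Y PY.
apply: (@card_le_trans _ _ _ D).
  apply: card_le_trans (card_image_le (fun f => f X) D).
  by apply: subset_card_le => x /XD[f Df fX]; exists f.
have [h] : $|{injfun D >-> Y}|.
  apply/injfunPex; exists (fun f => f Y) => [f Df|f g]; first exact: (DX f).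
  by rewrite !inE => Df Dg; exact: Dinj.
exact: inj_card_le.
Qed.

Lemma exists_is_min_size (T U : Type) (P : set (set T)) (phi : T -> U) :
  injective phi -> P !=set0 -> exists K : set U, is_min_size P K.
Proof.
move=> phi_inj /exists_min_card[X PX Xmin]; exists (phi @` X).
have phiX : phi @` X #= X.
  by apply: inj_card_eq => x y _ _; exact: phi_inj.
split; first by exists X => //; rewrite card_eq_sym.
by move=> Y /Xmin XY; rewrite (card_le_eql phiX).
Qed.

(** There are only countably many finite sets of naturals, so a coloring is coded by the codes of
    the sets it sends to [true]. This lets the minimum be represented by a set of subsets of
    omega. *)
Lemma coloring_code (B : set (set nat)) :
  (forall s, B s -> finite_set s) ->
  exists phi : (set_type B -> bool) -> set nat, injective phi.
Proof.
move=> Bfin.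
have : countable B.
  apply: sub_countable (countable_finite_subset (countableP [set: nat])).
  by apply: subset_card_le => s /Bfin.
move=> /countable_injP[code code_inj].
exists (fun pi => [set n | exists2 s : B, pi s & code (set_val s) = n]).
move=> pi pi' E; apply/funext => s.
have sub (f g : B -> bool) :
    [set n | exists2 s : B, f s & code (set_val s) = n] =
    [set n | exists2 s : B, g s & code (set_val s) = n] -> f s -> g s.
  move=> fg fs; have : [set n | exists2 s : B, g s & code (set_val s) = n]
    (code (set_val s)) by rewrite -fg; exists s.
  move=> [t gt] /code_inj; rewrite !inE => ts.
  by rewrite -(val_inj (ts (set_valP t) (set_valP s))).
by apply/idP/idP; apply: sub.
Qed.

(** * From pairs to an arbitrary barrier *)

(** Pulling the colorings back along an increasing map into [M] relativizes the hypothesis to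
    [M]. *)
Lemma pair_homogeneous (I : Type) (r : I -> nat -> nat -> bool) (M : set nat) :
  homogenizable (subsets_of_size 2) I -> infinite_set M ->
  exists H, [/\ H `<=` M, infinite_set H & forall i, exists (n : nat) (c : bool),
    forall a b, H a -> H b -> (n <= a)%N -> (a < b)%N -> r i a b = c].
Proof.
move=> hom Minf; have [e eS eM] := infinite_diagonal (fun=> Minf).
pose p i s := `[< exists a b, [/\ (a < b)%N, s = [set a; b] & r i (e a) (e b)] >].
have [H Hinf Hp] := hom p; exists (e @` H); split.
- by move=> _ [j _ <-].
- exact: infinite_image_homo.
- move=> i; have [n [c cP]] := Hp i; exists (e n), c => _ _ [a Ha <-] [b Hb <-].
  rewrite leqNgt !homo_ltn_mono// -leqNgt => na ab.
  rewrite -(cP [set a; b]); last 3 first.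
  + by apply/subsets_of_size2P; exists a, b.
  + by move=> _ [->|->].
  + by move=> _ [->//|->]; exact: leq_trans na (ltnW ab).
  apply/idP/asboolP => [rab|[a' [b' [ab' E rab]]]]; first by exists a, b.
  by have [-> ->] := set2_ltn_inj ab ab' E.
Qed.

(* [t] is not required to lie above [s]: the node is a set, not a sequence. *)
Definition decided (B : set (set nat)) (I : Type) (p : I -> set nat -> bool)
    (s H : set nat) : Prop :=
  forall i, exists (n : nat) (c : bool), forall t, B (s `|` t) -> t `<=` H ->
    (forall x, t x -> (n <= x)%N) -> p i (s `|` t) = c.

Definition decidable_below (B : set (set nat)) (I : Type)
    (p : I -> set nat -> bool) (s : set nat) : Prop :=
  forall M, infinite_set M -> exists H,
    [/\ H `<=` M, infinite_set H & decided B p s H].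

(** By the antichain condition a member of [B] that includes [s] equals [b], hence [s], so at most
    one set is left to color. *)
Lemma decidable_below_leaf (B : set (set nat)) (I : Type)
    (p : I -> set nat -> bool) (s : set nat) :
  barrier B -> (exists2 b, B b & b `<=` s) -> decidable_below B p s.
Proof.
move=> barB [b Bb bs] M Minf; exists M; split=> // i; exists 0, (p i s) => t Bt _ _.
have bE := barrier_antichain barB Bb Bt (subset_trans bs (@subsetUl _ _ _)).
by congr p; apply/seteqP; split=> [|x sx]; [rewrite -bE|left].
Qed.

Lemma decidable_below_step (B : set (set nat)) (I : Type)
    (p : I -> set nat -> bool) (s : set nat) (m : nat) :
  barrier B -> homogenizable (subsets_of_size 2) I ->
  (forall k, (m <= k)%N -> decidable_below B p (k |` s)) ->
  decidable_below B p s.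
Proof.
move=> barB hom dec_succ.
have [/(decidable_below_leaf p barB)//|nBs M Minf] :=
  EM (exists2 b, B b & b `<=` s).
(* [F (k, A)] thins [A] to decide the node s + {k}; for [k < m] no thinning is asked for. *)
have /choice[F FP] : forall kA : nat * set nat, exists A', infinite_set kA.2 ->
    [/\ A' `<=` kA.2, infinite_set A' & (m <= kA.1)%N ->
        decided B p (kA.1 |` s) A'].
  move=> [k A]; have [Ainf|nA] := EM (infinite_set A); last by exists A.
  have [mk|km] := leqP m k.
    by have [A' [? ? ?]] := dec_succ _ mk _ Ainf; exists A'.
  by exists A => _; split=> // mk; move: km; rewrite ltnNge mk.
pose fix A j := if j is j'.+1 then F (j', A j') else M.
have Ainf j : infinite_set (A j).
  by elim: j => // j IH; have [] := FP (j, A j) IH.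
have Adec i j : (i <= j)%N -> A j `<=` A i.
  elim: j => [|j IH]; first by rewrite leqn0 => /eqP ->.
  rewrite leq_eqVlt => /orP[/eqP -> //|/IH Aij].
  by have [+ _ _] := FP (j, A j) (Ainf j) => /subset_trans; apply.
(* As [A] decreases, all but finitely many points of [range e] lie in any given [A j]. *)
have [e eS eA] := infinite_diagonal Ainf.
have eI : infinite_set (range e) by exact: infinite_image_homo infinite_nat.
have /choice[fc fcP] : forall ik : I * nat, exists nc : nat * bool,
    (m <= ik.2)%N -> forall t, B ((ik.2 |` s) `|` t) -> t `<=` range e ->
      (forall x, t x -> (nc.1 <= x)%N) -> p ik.1 ((ik.2 |` s) `|` t) = nc.2.
  move=> [i k] /=; have [mk|km] := leqP m k; last first.
    by exists (0, false) => mk; move: km; rewrite ltnNge mk.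
  have [_ _ /(_ mk i)[n [c cP]]] := FP (k, A k) (Ainf k).
  (* Points of [range e] from [e k.+1] on lie in [A k.+1], the set chosen to decide the node of
     [k]. *)
  exists (maxn n (e k.+1), c) => _ t Bt te tn; apply: cP => // x tx; last first.
    by have := tn _ tx; rewrite geq_max => /andP[].
  have [j _ xE] := te _ tx; apply: (Adec k.+1 j); last by rewrite -xE.
  have := tn _ tx; rewrite geq_max -xE => /andP[_].
  by rewrite leqNgt (homo_ltn_mono eS) -leqNgt.
have [H1 [H1e H1inf H1c]] :=
  pair_homogeneous (fun i k _ => (fc (i, k)).2) hom eI.
have [H2 [H21 H2inf H2f]] :=
  pair_homogeneous (fun i k x => (fc (i, k)).1 <= x)%N hom H1inf.
exists H2; split=> //.
  by move=> x /H21/H1e[j _ <-]; exact: Adec (leq0n j) _ (eA j).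
have H2gt n : exists2 x, H2 x & (n < x)%N.
  exact: (infinite_set_natP H2).1 H2inf n.+1.
move=> i; have [n1 [c1 c1P]] := H1c i; have [n2 [c2 c2P]] := H2f i.
(* The color of the threshold coloring is [true]: for fixed k, any large x passes
   the threshold. *)
have c2T : c2.
  have [k H2k k_n2] := H2gt n2.
  have [x H2x xk] := H2gt (maxn k (fc (i, k)).1).
  rewrite -(c2P k x)//; [|exact: ltnW|]; move: xk; rewrite gtn_max => /andP[]//.
  by move=> _ /ltnW.
exists (maxn m (maxn n1 n2)), c1 => t Bt tH tn.
(* An empty [t] would put [s] itself in [B]. The least element [k] of [t] selects the node s + {k};
   the remaining elements must be shown to pass the threshold of [k]. *)
have [|k tk kmin] := @nonempty_nat_min t.
  apply/set0P/eqP => t0; apply: nBs; exists (s `|` t) => //.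
  by rewrite t0 setU0.
have := tn _ tk; rewrite !geq_max => /and3P[mk n1k n2k].
have stE : s `|` t = (k |` s) `|` (t `\ k).
  by rewrite (setUC [set k]) -setUA setDUK// => _ ->.
(* [x] merely completes [k] to a pair, whose color is c_i(k) for any choice of [x]. *)
have [x H2x xk] := H2gt k.
rewrite -(c1P k x)//; [|exact/H21/tH|exact: H21].
rewrite stE; apply: (fcP (i, k)) => //=; first by rewrite -stE.
  by move=> y [/tH/H21/H1e].
move=> y [ty yk]; rewrite (c2P k y)//; [exact: tH|exact: tH|].
by rewrite ltn_neqAle kmin// andbT; apply/eqP => ky; apply: yk.
Qed.

(** A bad root would start an infinite chain of bad nodes, each adding one point. The set of added
    points has an initial segment in [B]; being finite, it is included in some node of the chain,
    which is then a leaf and not bad. *)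
Lemma barrier_decidable (B : set (set nat)) (I : Type)
    (p : I -> set nat -> bool) :
  barrier B -> homogenizable (subsets_of_size 2) I -> decidable_below B p set0.
Proof.
move=> barB hom; apply: contrapT => bad0.
have /choice[g gP] : forall sn : set nat * nat, exists k,
    ~ decidable_below B p sn.1 ->
    (sn.2 <= k)%N /\ ~ decidable_below B p (k |` sn.1).
  move=> [s n] /=; apply: contrapT => /forallNP nk.
  have bads : ~ decidable_below B p s.
    by move=> ds; apply: (nk 0) => /(_ ds).
  apply: bads; apply: (decidable_below_step (m := n)) => // k nk'.
  by apply: contrapT => badk; apply: (nk k).
(* The second component bounds the next point from below, so that the added points increase. *)
pose fix u j := if j is j'.+1 then
  (g (u j') |` (u j').1, (g (u j')).+1) else (set0 : set nat, 0).
have bad j : ~ decidable_below B p (u j).1.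
  by elim: j => // j IH; have [] := gP _ IH.
have u2 j : (j <= (u j).2)%N.
  by elim: j => // j IH; apply: leq_ltn_trans IH _; have [] := gP _ (bad j).
have gu j : (j <= g (u j))%N.
  by apply: leq_trans (u2 j) _; have [] := gP _ (bad j).
have u1 i j : (i <= j)%N -> (u i).1 `<=` (u j).1.
  elim: j => [|j IH]; first by rewrite leqn0 => /eqP ->.
  rewrite leq_eqVlt => /orP[/eqP -> //|/IH uij].
  by apply: subset_trans uij _; exact: subsetUr.
have Ninf : infinite_set (range (g \o u)).
  apply/infinite_set_natP => n; exists (g (u n)); [by exists n|exact: gu].
have [b Bb [bN _]] := barrier_segment barB Ninf.
have /finite_set_natP[n bn] := barrier_finite barB Bb.
apply: (bad n); apply: decidable_below_leaf => //; exists b => // x bx.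
(* The point [x] was added at a stage [j <= x < n], so it already belongs to the node at [n]. *)
have [j _ xE] := bN _ bx; apply: (u1 j.+1); last by left.
by apply: leq_ltn_trans (gu j) _; rewrite [g _]xE; exact: bn.
Qed.

Lemma homogenizable_barrier (B : set (set nat)) (I : Type) :
  barrier B -> homogenizable (subsets_of_size 2) I -> homogenizable B I.
Proof.
move=> barB hom p.
have [H [_ Hinf Hdec]] := barrier_decidable p barB hom infinite_nat.
exists H => // i; have [n [c cP]] := Hdec i; exists n, c => s Bs sH sn.
by have := cP s; rewrite set0U; apply.
Qed.

(** * From a non-trivial barrier to pairs *)

(** Let {n} be missing from [B] and m > n. The member of [B] that begins {n} together with all x >=
    m is not inside {n}, so it contains m. If {m} were in [B], this member would be {m}, yet it must
    also contain n. *)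
Lemma nontrivial_barrier_singletons (B : set (set nat)) :
  nontrivial_barrier B ->
  exists n, forall m, (n <= m)%N -> ~ B [set m].
Proof.
move=> [barB B1]; have [n nB] : exists n, ~ B [set n].
  apply: contrapT => /forallNP allB; apply: B1.
  have {}allB n : B [set n] by apply: contrapT; exact: allB.
  apply/seteqP; split=> [s Bs|s /subsets_of_size1P[n ->]//].
  have [x sx] := barrier_nonempty barB Bs; apply/subsets_of_size1P; exists x.
  by apply/esym/(barrier_antichain barB) => // _ ->.
exists n => m nm Bm; have mn : m <> n by move=> mn; rewrite mn in Bm.
have [|s Bs [sN sinit]] :=
    @barrier_segment _ barB (n |` [set x | (m <= x)%N]).
  by apply/infinite_set_natP => k; exists (maxn m k);
    [right; rewrite /= leq_maxl|rewrite leq_maxr].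
have ns : ~ s `<=` [set n].
  move=> sn; apply: nB; suff <- : s = [set n] by [].
  apply/seteqP; split=> // _ ->.
  by have [x sx] := barrier_nonempty barB Bs; have <- := sn _ sx.
have [x sx mx] : exists2 x, s x & (m <= x)%N.
  by have /existsNP[x /not_implyP[sx xn]] := ns; exists x => //; have [] := sN _ sx.
have sm : s m.
  move: mx; rewrite leq_eqVlt => /orP[/eqP -> //|mx].
  by apply: (sinit x) => //; right => /=.
have smE : [set m] = s by apply: (barrier_antichain barB) => // _ ->.
have sn : s n by apply: (sinit m) => //; [left|lia].
by move: sn; rewrite -smE => /esym.
Qed.

(** For a < b in [H] with {a} not in [B], the member of [B] that begins {a, b} together with the
    part of [H] above b has a and b as its first two elements and lies in [H], so it carries the
    color of the pair. *)
Lemma homogenizable_pairs (B : set (set nat)) (I : Type) :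
  nontrivial_barrier B -> homogenizable B I ->
  homogenizable (subsets_of_size 2) I.
Proof.
move=> ntB hom p; have [barB _] := ntB.
have [m mB] := nontrivial_barrier_singletons ntB.
pose first2 (s : set nat) a b :=
  [/\ s a, s b, (a < b)%N & forall x, s x -> x = a \/ (b <= x)%N].
pose q i s := `[< exists a b, first2 s a b /\ p i [set a; b] >].
have [H Hinf Hq] := hom q; exists H => // i; have [n [c cP]] := Hq i.
exists (maxn n m), c => _ /subsets_of_size2P[a [b [ab ->]]] abH abn.
have [Ha Hb] : H a /\ H b by split; apply: abH; [left|right].
have := abn a (or_introl erefl); rewrite geq_max => /andP[na ma].
have [|s Bs [sN sinit]] :=
    @barrier_segment _ barB ([set a; b] `|` [set x | H x /\ (b < x)%N]).
  apply/infinite_set_natP => k; move/infinite_set_natP: Hinf.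
  move=> /(_ (maxn k b.+1))[x Hx]; rewrite geq_max => /andP[kx bx].
  by exists x => //; right.
have sge x : s x -> x = a \/ (b <= x)%N.
  by move=> /sN[[->|->]|[_ /= /ltnW]]; [left|right|right].
have sa : s a.
  have [x sx] := barrier_nonempty barB Bs.
  have [<- //|bx] := sge _ sx; apply: (sinit x) => //; first by left; left.
  exact: leq_trans ab bx.
have sb : s b.
  have [x sx bx] : exists2 x, s x & (b <= x)%N.
    apply: contrapT => nx; apply: (mB a ma); suff <- : s = [set a] by [].
    apply/seteqP; split=> [x sx|_ ->//]; have [//|bx] := sge _ sx.
    by case: nx; exists x.
  move: bx; rewrite leq_eqVlt => /orP[/eqP -> //|bx].
  by apply: (sinit x) => //; left; right.
rewrite -(cP s)//; last 2 first.
- by move=> x /sN[[->|->]|[]].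
- by move=> x /sge[->//|]; lia.
apply/idP/asboolP => [pab|[a' [b' [[sa' sb' ab' s'ge] pab]]]].
  by exists a, b.
suff [-> ->] : a = a' /\ b = b' by [].
by have := sge _ sa'; have := sge _ sb'; have := s'ge _ sa; have := s'ge _ sb; lia.
Qed.

(** * Singletons and the splitting number *)

Lemma singletons_barrier : barrier (subsets_of_size 1).
Proof.
split=> [s s1|s /subsets_of_size1P[n ->]|s t|N Ninf].
- by apply/finite_setP; exists 1.
- by exists n.
- move=> /subsets_of_size1P[n ->] /subsets_of_size1P[k ->] /(_ n erefl).
  by move=> /= ->.
have [k Nk kmin] := nonempty_nat_min (infinite_setN0 Ninf).
exists [set k]; first by apply/subsets_of_size1P; exists k.
split=> [_ ->//|_ y -> Ny yk].
by move: (kmin _ Ny); rewrite leqNgt yk.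
Qed.

(** Provides the nonemptiness on which the existence of the minima rests. The even-indexed terms of
    an increasing sequence in [A] split [A]. *)
Lemma splitting_family_infinite_sets : splitting_family [set X | infinite_set X].
Proof.
split=> // A Ainf; have [e eS eA] := infinite_diagonal (fun=> Ainf).
have e_inj i j : e i = e j -> i = j.
  by move=> eij; case: (ltngtP i j) => // /eS; rewrite eij ltnn.
have evens : infinite_set [set i | ~~ odd i].
  by apply/infinite_set_natP => n; exists n.*2; rewrite /= ?odd_double//; lia.
have odds : infinite_set [set i | odd i].
  by apply/infinite_set_natP => n; exists n.*2.+1; rewrite /= ?odd_double//; lia.
exists (e @` [set i | ~~ odd i]); split; first exact: infinite_image_homo.
- apply: sub_infinite_set (infinite_image_homo eS evens).
  by move=> _ [i i_even <-]; split=> //; exists i.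
- apply: sub_infinite_set (infinite_image_homo eS odds).
  move=> _ [i /= i_odd <-]; split=> // -[j /= j_even /e_inj ji].
  by rewrite ji i_odd in j_even.
Qed.

(** Each [X] colors {n} by whether n is in [X]; a set split by [X] sees both colors beyond every
    bound. *)
Lemma splitting_no_almost_monochromatic (S : set (set nat)) :
  splitting_family S ->
  exists2 Y : set (set_type (subsets_of_size 1) -> bool),
    no_almost_monochromatic Y & Y #<= S.
Proof.
move=> [_ splitS]; pose p (X s : set nat) := `[< s `<=` X >].
exists ((fun X (s : subsets_of_size 1) => p X (set_val s)) @` S); last first.
  exact: card_image_le.
move=> [H [Hinf Hmono]]; have [X [SX HX HnX]] := splitS _ Hinf.
have : eventually_constant (subsets_of_size 1) (p X) H.
  by apply/(almost_monochromaticP (fun=> erefl) Hinf); apply: Hmono; exists X.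
move=> [n [c cP]].
move/infinite_set_natP: HX => /(_ n)[x [Hx Xx] nx].
move/infinite_set_natP: HnX => /(_ n)[y [Hy nXy] ny].
have single z : H z -> (n <= z)%N -> `[< X z >] = c.
  move=> Hz nz; rewrite -(cP [set z]); [|by apply/subsets_of_size1P; exists z| |].
  - by rewrite /p; congr asbool; apply/propext; split=> [Xz _ ->//|]; apply.
  - by move=> _ ->.
  - by move=> _ ->.
by move: (single _ Hx nx) (single _ Hy ny); rewrite (asboolT Xx) (asboolF nXy) => <-.
Qed.

Lemma no_almost_monochromatic_splitting
    (Y : set (set_type (subsets_of_size 1) -> bool)) :
  no_almost_monochromatic Y -> exists2 S, splitting_family S & S #<= Y.
Proof.
move=> nY.
have single n : subsets_of_size 1 [set n] by apply/subsets_of_size1P; exists n.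
pose pt n : subsets_of_size 1 := SigSub (mem_set (single n)).
pose trace (pi : subsets_of_size 1 -> bool) := [set n | pi (pt n)].
(* Dropping finite traces is harmless: their colorings are eventually [false] on every set. *)
exists [set X | (trace @` Y) X /\ infinite_set X]; last first.
  apply: card_le_trans (card_image_le trace Y).
  by apply: subset_card_le => X [].
split=> [X []//|A Ainf]; apply: contrapT => nX; apply: nY; exists A; split=> // pi Ypi.
pose p s := `[< exists2 n, s = [set n] & pi (pt n) >].
have pip (s : subsets_of_size 1) : pi s = p (set_val s).
  have /subsets_of_size1P[n sE] := set_valP s.
  have -> : s = pt n by apply: val_inj.
  apply/idP/asboolP => [pin|[k /= nk pik]]; first by exists n.
  have /= -> : n = k by have : [set k] n by rewrite -nk.
  exact: pik.
apply/(almost_monochromaticP pip Ainf).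
have trE n : p [set n] = `[< trace pi n >].
  by rewrite -[in LHS](pip (pt n)) /trace /= asboolb.
have [Xfin|Xinf] := EM (finite_set (A `&` trace pi)).
  have [n nP] := (finite_set_natP _).1 Xfin.
  exists n, false => _ /subsets_of_size1P[k ->] kA /(_ k erefl) nk.
  rewrite trE; apply: asboolF => trk.
  by have := nP k (conj (kA k erefl) trk); rewrite ltnNge nk.
have [Xfin|Xinf'] := EM (finite_set (A `\` trace pi)).
  have [n nP] := (finite_set_natP _).1 Xfin.
  exists n, true => _ /subsets_of_size1P[k ->] kA /(_ k erefl) nk.
  rewrite trE; apply: asboolT; apply: contrapT => ntrk.
  by have := nP k (conj (kA k erefl) ntrk); rewrite ltnNge nk.
case: nX; exists (trace pi); split=> //; split; first by exists pi.
by apply: contra_not Xinf; exact: finite_setIr.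
Qed.

Theorem corollary6p4 :
  (forall B : set (set nat), nontrivial_barrier B ->
     exists kappa : set (set nat), is_par B kappa /\ is_par2 kappa) /\
  (exists kappa : set (set nat),
     is_par (subsets_of_size 1) kappa /\ is_splitting_number kappa).
Proof.
split=> [B ntB|].
  have [barB _] := ntB.
  have pairs_to_B X := @no_almost_monochromatic_transfer _ _ X
    (fun I => @homogenizable_pairs B I ntB).
  have B_to_pairs X := @no_almost_monochromatic_transfer _ _ X
    (fun I => @homogenizable_barrier B I barB).
  (* A family without a common almost monochromatic set is carried from singletons to pairs and then
     to [B]. *)
  have B_nonempty : (@no_almost_monochromatic B) !=set0.
    have [Y nY _] :=
      splitting_no_almost_monochromatic splitting_family_infinite_sets.
    have [Z nZ _] := no_almost_monochromatic_transfer
      (fun I => @homogenizable_barrier _ I singletons_barrier) nY.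
    by have [W nW _] := pairs_to_B _ nZ; exists W.
  have [phi phi_inj] := coloring_code (fun s => @barrier_finite B barB s).
  have [K Kmin] := exists_is_min_size phi_inj B_nonempty.
  by exists K; split=> //; apply: is_min_size_transfer Kmin.
have [|K Kmin] := @exists_is_min_size _ _ splitting_family id (@inj_id _).
  by exists [set X | infinite_set X]; exact: splitting_family_infinite_sets.
exists K; split=> //; apply: is_min_size_transfer Kmin.
  exact: splitting_no_almost_monochromatic.
exact: no_almost_monochromatic_splitting.
Qed.
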